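(* Let $A$ be a finite abelian group. For every $t\geq0$, the trace pairing $(x,y)\mapsto\mathrm{Tr}(xy)$ on $\mathcal{A}\simeq\mathrm{End}_{\mathbb{C}}(\mathcal{H})$ induces a vector-space isomorphism $$\mathcal{C}_t^{\mathrm{q}}\ \xrightarrow{\ \sim\ }\ \mathfrak{D}_{2t}(A).$$ Under this isomorphism, composition in $\mathcal{C}_t^{\mathrm{q}}$ becomes a contraction product on $\mathfrak{D}_{2t}(A)$, rather than the ordinary multiplication inherited from $\mathcal{A}^{\otimes 2t}$.
   Context: **Setting.** $A$ is a finite abelian group, written additively; $\widehat{A}=\mathrm{Hom}(A,U(1))$; $V_A=A\oplus\widehat{A}$ (written additively); $\beta_A((a,\chi),(b,\psi))=\chi(b)$. Let $\mathcal{H}=\mathbb{C}[A]$ with orthonormal basis $|b\rangle$, $b\in A$; for $v=(a,\chi)\in V_A$ let $W_v|b\rangle=\chi(b)|a+b\rangle$; $H(A)=\{zW_v:z\in U(1),v\in V_A\}$ and $C(A)=N_{U(\mathcal{H})}(H(A))/(U(1)\cdot I)$ is the projective Clifford group. For $g\in C(A)$ let $U_g$ be a unitary representative of $g$. **Weyl algebra.** $\mathcal{A}=\mathbb{C}_{\beta_A}[V_A]$ has basis $\{u_v\}_{v\in V_A}$ and product $u_vu_w=\beta_A(v,w)u_{v+w}$; $u_v\mapsto W_v$ identifies $\mathcal{A}$ with $\mathrm{End}_{\mathbb{C}}(\mathcal{H})$. $C(A)$ acts on $\mathcal{A}\simeq\mathrm{End}_{\mathbb{C}}(\mathcal{H})$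 by $\alpha_g=\mathrm{Ad}(U_g)$, i.e. $x\mapsto U_gxU_g^{-1}$, and diagonally on tensor powers. **Commutants.** $\mathcal{C}_t^{\mathrm{q}}=\mathrm{End}_{C(A)}(\mathcal{A}^{\otimes t})$. For $s\geq1$, $\mathfrak{D}_s(A)=\{X\in\mathrm{End}_{\mathbb{C}}(\mathcal{H}^{\otimes s}):XU_g^{\otimes s}=U_g^{\otimes s}X\ \forall g\in C(A)\}$, which under $\mathcal{A}^{\otimes s}\simeq\mathrm{End}_{\mathbb{C}}(\mathcal{H}^{\otimes s})$ is $(\mathcal{A}^{\otimes s})^{C(A)}$; $\mathfrak{D}_0(A)=\mathbb{C}$. **Induced map and contraction product.** The trace pairing identifies $(\mathcal{A}^{\otimes t})^*$ with $\mathcal{A}^{\otimes t}$, hence $\mathrm{End}_{\mathbb{C}}(\mathcal{A}^{\otimes t})\simeq\mathcal{A}^{\otimes t}\otimes(\mathcal{A}^{\otimes t})^*\simeq\mathcal{A}^{\otimes t}\otimes\mathcal{A}^{\otimes t}=\mathcal{A}^{\otimes 2t}$, where $x\otimes y$ corresponds to the endomorphism $z\mapsto\mathrm{Tr}(yz)x$. The contraction product is obtained by contracting the dual and primal tensor factors through the trace pairing: $(x\otimes y)*(x'\otimes y')=\mathrm{Tr}(yx')\,x\otimes y'$ for $x,y,x',y'\in\mathcal{A}^{\otimes t}$. *)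

(* Defs.v *)
From HB Require Import structures.
From mathcomp Require Import all_boot all_order all_algebra.
From mathcomp Require Import fingroup cyclic.
From mathcomp Require Import generic_quotient.
From mathcomp Require Import boolp classical_sets functions reals.
From mathcomp Require Import complex.

Set Implicit Arguments.
Unset Strict Implicit.
Unset Printing Implicit Defensive.

Import Order.TTheory GRing.Theory Num.Theory.
Local Open Scope ring_scope.
Local Open Scope classical_set_scope.

Section Dual.
Variables (C : numClosedFieldType) (A : finZmodType).

Definition is_character (f : {ffun A -> C}) : bool :=
  [forall a, `|f a| == 1] && [forall a, forall b, f (a + b) == f a * f b].

Record dual := Dual { dual_val :> {ffun A -> C}; _ : is_character dual_val }.

HB.instance Definition _ := [isSub for dual_val].
HB.instance Definition _ := [Choice of dual by <:].

Lemma dual_norm (x : dual) a : `|x a| = 1.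
Proof. by case: x => f /= /andP[/forallP h _]; apply/eqP. Qed.

Lemma dual_neq0 (x : dual) a : x a != 0.
Proof. by rewrite -normr_gt0 dual_norm ltr01. Qed.

Lemma dualD (x : dual) a b : x (a + b) = x a * x b.
Proof. by case: x => f /= /andP[_ /forallP/(_ a)/forallP/(_ b)/eqP]. Qed.

Lemma dual0 (x : dual) : x 0 = 1.
Proof. by apply: (mulfI (dual_neq0 x 0)); rewrite -dualD addr0 mulr1. Qed.

Lemma dual_eqP (x y : dual) : (forall a, x a = y a) -> x = y.
Proof. by move=> h; apply/val_inj/ffunP. Qed.

(* The group law of the dual is pointwise multiplication. *)
Fact dual_zero_subproof : is_character [ffun => 1].
Proof.
apply/andP; split; apply/forallP => a; first by rewrite ffunE normr1.
by apply/forallP => b; rewrite !ffunE mulr1.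
Qed.
Definition dual_zero := Dual dual_zero_subproof.

Fact dual_opp_subproof (x : dual) : is_character [ffun a => (x a)^-1].
Proof.
apply/andP; split; apply/forallP => a; first by rewrite ffunE normfV dual_norm invr1.
by apply/forallP => b; rewrite !ffunE dualD invfM.
Qed.
Definition dual_opp x := Dual (dual_opp_subproof x).

Fact dual_add_subproof (x y : dual) : is_character [ffun a => x a * y a].
Proof.
apply/andP; split; apply/forallP => a.
  by rewrite ffunE normrM !dual_norm mulr1.
by apply/forallP => b; rewrite !ffunE !dualD mulrACA.
Qed.
Definition dual_add x y := Dual (dual_add_subproof x y).

Fact dual_addA : associative dual_add.
Proof. by move=> x y z; apply: dual_eqP => a; rewrite !ffunE mulrA. Qed.
Fact dual_addC : commutative dual_add.
Proof. by move=> x y; apply: dual_eqP => a; rewrite !ffunE mulrC. Qed.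
Fact dual_add0 : left_id dual_zero dual_add.
Proof. by move=> x; apply: dual_eqP => a; rewrite !ffunE mul1r. Qed.
Fact dual_addN : left_inverse dual_zero dual_opp dual_add.
Proof. by move=> x; apply: dual_eqP => a; rewrite !ffunE mulVf ?dual_neq0. Qed.

HB.instance Definition _ :=
  GRing.isZmodule.Build dual dual_addA dual_addC dual_add0 dual_addN.

(* Finiteness: character values are #|A|-th roots of unity. *)
Definition unity_roots : seq C :=
  sval (closed_field_poly_normal ('X^#|A| - 1 : {poly C})).

Fact dual_unity_root (x : dual) a : x a \in unity_roots.
Proof.
have A_gt0 : (0 < #|A|)%N by apply/card_gt0P; exists 0.
have xX n : x (a *+ n) = x a ^+ n.
  by elim: n => [|n IHn]; rewrite ?mulr0n ?dual0 // mulrS exprS dualD IHn.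
have aA : a *+ #|A| = 0.
  by rewrite -FinRing.zmodXgE -cardsT expg_cardG ?inE.
have : root ('X^#|A| - 1 : {poly C}) (x a).
  by rewrite /root !hornerE -xX aA dual0 subrr.
rewrite /unity_roots; case: closed_field_poly_normal => r /= {1}->.
rewrite rootZ ?root_prod_XsubC // (monicP _) ?oner_eq0 //.
exact: monicXnsubC.
Qed.

Definition dual_code (x : dual) : {ffun A -> seq_sub unity_roots} :=
  [ffun a => SeqSub (dual_unity_root x a)].
Definition dual_decode (f : {ffun A -> seq_sub unity_roots}) : option dual :=
  insub [ffun a => val (f a)].
Fact dual_codeK : pcancel dual_code dual_decode.
Proof.
move=> x; rewrite /dual_decode.
suff -> : [ffun a => val (dual_code x a)] = val x by rewrite valK.
by apply/ffunP => a; rewrite !ffunE.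
Qed.

HB.instance Definition _ := PCanIsCountable dual_codeK.
HB.instance Definition _ : isFinite dual := PCanIsFinite dual_codeK.

End Dual.

Section Weyl.
Variables (C : numClosedFieldType) (A : finZmodType).

Notation V := (A * dual C A)%type.

Definition beta (v w : V) : C := v.2 w.1.

Definition weylmx (v : V) : 'M[C]_#|A| :=
  \matrix_(i, j) (v.2 (enum_val j) *+ (enum_val i == v.1 + enum_val j)).

Definition heisenberg : set 'M[C]_#|A| :=
  [set M | exists z v, `|z| = 1 /\ M = z *: weylmx v].

Definition normalizes_heisenberg (U : 'M[C]_#|A|) : Prop :=
  U \is unitarymx /\
  [set U *m M *m invmx U | M in heisenberg] = heisenberg.

Definition normalizer := {U : 'M[C]_#|A| | `[< normalizes_heisenberg U >]}.

Definition phase_eq (U U' : normalizer) : bool :=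
  `[< exists z : C, `|z| = 1 /\ val U' = z *: val U >].

Fact phase_eq_equiv : equiv_class_of phase_eq.
Proof.
split=> [U|U U'|U2 U1 U3].
- by apply/asboolP; exists 1; rewrite normr1 scale1r.
- apply/asbool_equiv_eq; split=> -[z [z1 ->]]; exists z^-1;
    by rewrite normfV z1 invr1 scalerA mulVf ?scale1r // -normr_gt0 z1.
- move=> /asboolP[z [z1 E2]] /asboolP[w [w1 E3]]; apply/asboolP.
  by exists (w * z); rewrite normrM z1 w1 mulr1 E3 E2 scalerA.
Qed.
Canonical phase_eq_rel := EquivRelPack phase_eq_equiv.

Definition clifford := {eq_quot phase_eq}%qT.

Definition clifford_rep (g : clifford) : 'M[C]_#|A| := val (repr g).

(* Elements of the Weyl algebra are given by their coordinates in the basis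
   (u_v), those of its s-th tensor power by their coordinates in the basis
   u_(v 0) (x) ... (x) u_(v (s - 1)), v in V^s. *)
Definition weyl := {ffun V -> C^o}.
Definition weylT (s : nat) := {ffun {ffun 'I_s -> V} -> C^o}.

Definition u_ (v : V) : weyl := [ffun w => (w == v)%:R].
Definition uT s (v : {ffun 'I_s -> V}) : weylT s := [ffun w => (w == v)%:R].

Definition weyl_mul s (x y : weylT s) : weylT s :=
  \sum_(v : {ffun 'I_s -> V}) \sum_(w : {ffun 'I_s -> V})
    (x v * y w * \prod_(i < s) beta (v i) (w i)) *: uT (v + w).

Definition tensor s (x : 'I_s -> weyl) : weylT s :=
  [ffun v : {ffun 'I_s -> V} => \prod_(i < s) x i (v i)].

Definition lpart s t (p : {ffun 'I_(s + t) -> V}) : {ffun 'I_s -> V} :=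
  [ffun i => p (lshift t i)].
Definition rpart s t (p : {ffun 'I_(s + t) -> V}) : {ffun 'I_t -> V} :=
  [ffun i => p (rshift s i)].
Definition tensor2 s t (x : weylT s) (y : weylT t) : weylT (s + t) :=
  [ffun p : {ffun 'I_(s + t) -> V} => x (lpart p) * y (rpart p)].

(* The space H^(x)s has basis A^s; its endomorphisms are matrices indexed by
   A^s through enum_val. *)
Definition tensor_op s (M : 'I_s -> 'M[C]_#|A|) : 'M[C]_#|{ffun 'I_s -> A}| :=
  \matrix_(i, j) \prod_(k < s)
     M k (enum_rank ((enum_val i : {ffun 'I_s -> A}) k))
         (enum_rank ((enum_val j : {ffun 'I_s -> A}) k)).

Definition weyl_op (x : weyl) : 'M[C]_#|A| := \sum_(v : V) x v *: weylmx v.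
Definition weyl_opT s (x : weylT s) : 'M[C]_#|{ffun 'I_s -> A}| :=
  \sum_(v : {ffun 'I_s -> V}) x v *: tensor_op (fun k => weylmx (v k)).

(* The inverse of weyl_op: (u, w) |-> tr (W_u^-1 W_w) is #|A| times the
   identity matrix. *)
Definition op_weyl (M : 'M[C]_#|A|) : weyl :=
  [ffun v => \tr (invmx (weylmx v) *m M) / #|A|%:R].

Definition weyl_tr s (x : weylT s) : C := \tr (weyl_opT x).

Definition alpha (g : clifford) (x : weyl) : weyl :=
  op_weyl (clifford_rep g *m weyl_op x *m invmx (clifford_rep g)).

Definition alphaT s (g : clifford) (x : weylT s) : weylT s :=
  \sum_(v : {ffun 'I_s -> V}) x v *: tensor (fun k => alpha g (u_ (v k))).

Definition commutant t : set 'End(weylT t) :=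
  [set f | forall g x, f (alphaT g x) = alphaT g (f x)].

Definition clifford_invariants s : set 'M[C]_#|{ffun 'I_s -> A}| :=
  [set X | forall g : clifford,
     X *m tensor_op (fun=> clifford_rep g) =
     tensor_op (fun=> clifford_rep g) *m X].

Definition trace_endo t (x y : weylT t) : 'End(weylT t) :=
  linfun (fun z => weyl_tr (weyl_mul y z) *: x).

(* The bilinear extension of (x (x) y) * (x' (x) y') = Tr(y x') x (x) y'. *)
Definition contraction t (X Y : weylT (t + t)) : weylT (t + t) :=
  \sum_(p : {ffun 'I_(t + t) -> V}) \sum_(q : {ffun 'I_(t + t) -> V})
    (X p * Y q * weyl_tr (weyl_mul (uT (rpart p)) (uT (lpart q)))) *:
    tensor2 (uT (lpart p)) (uT (rpart q)).

End Weyl.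

(* Main.v *)
Require Import Defs.
From HB Require Import structures.
From mathcomp Require Import all_boot all_order all_algebra.
From mathcomp Require Import fingroup cyclic.
From mathcomp Require Import boolp classical_sets functions reals.
From mathcomp Require Import complex.

(** Write N for the order of A, V for A times its dual, u_v (v in V^s) for the
    basis of the s-th tensor power of the Weyl algebra and W_v for the operator
    that u_v stands for.

    Two facts about Weyl operators carry the proof. First, Tr (u_v u_w) is
    nonzero exactly when w = - v: the trace of W_v is a character sum, hence
    vanishes unless v = 0. So the trace pairing is nondegenerate, the basis dual
    to (u_v) consists of multiples of the u_(- v), and x |-> weyl_opT x is
    injective. Second, weyl_opT is onto, since every elementary matrix is a
    combination of the W_v; this is dual character orthogonality, and rests on
    the characters of A separating its points (characters_separate), proved by
    diagonalizing all the translations of A simultaneously.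

    The isomorphism is the one sending an endomorphism f to the sum over v of
    f (u_v) (x) u_v', where u_v' denotes the trace-dual basis. In coordinates
    this is theta; it maps z |-> Tr (y z) x to x (x) y, and its inverse endo_of
    extends x (x) y |-> trace_endo x y linearly. Composing two of these rank one
    endomorphisms gives the contraction product (theta_comp).

    Under weyl_opT the Clifford group acts by conjugation by U_g^((x) s)
    (weyl_opT_alphaT). It therefore preserves the trace pairing, and acts on
    x (x) y factorwise, so that endo_of is equivariant (endo_of_alphaT):
      endo_of (g X) (g z) = g (endo_of X z).
    Because each g acts surjectively, f lies in the commutant if and only if
    theta f is fixed by every g (commutantE), that is, if and only if
    weyl_opT (theta f) commutes with every U_g^((x) 2t) (clifford_invariantE).

    Finally, the endomorphism f : z |-> Tr (z) 1 lies in the commutant and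
    satisfies f o f = N^t f, while theta f = 1 (x) 1 squares to itself in the
    tensor power of the Weyl algebra: for N^t > 1 the two products differ. *)

Set Implicit Arguments.
Unset Strict Implicit.
Unset Printing Implicit Defensive.

Import Order.TTheory GRing.Theory Num.Theory.
Local Open Scope ring_scope.
Local Open Scope classical_set_scope.

(** * Characters of a finite abelian group *)

Section Characters.
Variables (C : numClosedFieldType) (A : finZmodType).

Lemma cardA_neq0 : #|A|%:R != 0 :> C.
Proof. by rewrite pnatr_eq0 -lt0n; apply/card_gt0P; exists 0. Qed.

(** Multiplicativity forces the values to be #|A|-th roots of unity, hence of
    norm 1. *)
Lemma multiplicative_character (f : A -> C) :
  f 0 = 1 -> {morph f : a b / a + b >-> a * b} ->
  is_character [ffun a => f a].
Proof.
move=> f0 fD; apply/andP; split; apply/forallP => a; last first.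
  by apply/forallP => b; rewrite !ffunE fD.
have fX n : f (a *+ n) = f a ^+ n.
  by elim: n => [|n IHn]; rewrite ?mulr0n // mulrS exprS fD IHn.
have A_gt0 : (0 < #|A|)%N by apply/card_gt0P; exists 0.
have aA : a *+ #|A| = 0.
  by rewrite -FinRing.zmodXgE -cardsT expg_cardG ?inE.
by rewrite ffunE -(pexpr_eq1 A_gt0) // -normrX -fX aA f0 normr1.
Qed.

Definition translmx (a : A) : 'M[C]_#|A| :=
  \matrix_(i, j) (enum_val i == a + enum_val j)%:R.

Lemma translmx0 : translmx 0 = 1%:M.
Proof. by apply/matrixP=> i j; rewrite !mxE add0r (inj_eq enum_val_inj). Qed.

Lemma translmxD a b : translmx (a + b) = translmx a *m translmx b.
Proof.
apply/matrixP=> i j; rewrite !mxE (bigD1 (enum_rank (b + enum_val j))) //=.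
rewrite !mxE enum_rankK eqxx mulr1 addrA big1 ?addr0 // => k.
rewrite !mxE; case: (enum_val k =P _) => [<-|_ _]; last exact: mulr0.
by rewrite enum_valK eqxx.
Qed.

Lemma translmx_adj a : map_mx Num.conj (translmx a)^T = translmx (- a).
Proof.
apply/matrixP=> i j; rewrite !mxE rmorph_nat; congr (_%:R : C).
by rewrite eq_sym (can2_eq (addKr a) (addNKr a)).
Qed.

(** The translations are unitary, since the adjoint of translmx a is
    translmx (- a); being normal, they are diagonalizable, and they commute. *)
Lemma codiagonalizable_transl : codiagonalizable [seq translmx a | a : A].
Proof.
apply/codiagonalizableP; split.
  move=> _ _ /mapP[a _ ->] /mapP[b _ ->].
  by rewrite /comm_mx -!translmxD addrC.
move=> _ /mapP[a _ ->]; have /orthomx_spectralP -> : translmx a \is normalmx.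
  by apply/normalmxP; rewrite translmx_adj -!translmxD addrC.
exists (spectralmx (translmx a)); first exact: spectral_unit.
apply/diagonalizable_forLR; first exact: spectral_unit.
by eexists; symmetry; apply: conjVmx; rewrite spectral_unit.
Qed.

(** In a common eigenbasis of the translations, each basis vector gives the
    character sending b to the eigenvalue d b 0 i of translmx b. If all of them
    are trivial at a then translmx a is the identity, and a = 0. *)
Lemma characters_separate (a : A) : (forall x : dual C A, x a = 1) -> a = 0.
Proof.
move=> xa1; have [P Pu /allP PD] := codiagonalizable_transl.
have {PD} PD b : exists d : 'rV[C]_#|A|, P *m translmx b = diag_mx d *m P.
  have /PD/diagonalizable_forPex[d] : translmx b \in [seq translmx a | a : A].
    exact: map_f (mem_enum _ _).
  by move/(simmxP Pu); exists d.
pose d b := sval (cid (PD b)); have Pd b : P *m translmx b = diag_mx (d b) *m P.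
  by rewrite /d; case: cid.
have dE b : diag_mx (d b) = P *m translmx b *m invmx P.
  by rewrite Pd mulmxK.
have d1 : diag_mx (d a) = 1%:M.
  apply/matrixP=> i j; rewrite !mxE; case: eqP => // _ {j}; rewrite mulr1n.
  have d0 : d 0 0 i = 1.
    have := congr1 (fun M : 'M_ _ => M i i) (dE 0).
    by rewrite translmx0 mulmx1 mulmxV // !mxE eqxx mulr1n.
  have dD : {morph (fun b => d b 0 i) : b c / b + c >-> b * c}.
    move=> b c; have := congr1 (fun M : 'M_ _ => M i i) (dE (b + c)).
    rewrite translmxD mulmxA -[P *m translmx b](mulmxKV Pu) -dE -!mulmxA.
    rewrite (mulmxA P) -dE mulmx_diag !mxE eqxx !mulr1n; exact.
  have := xa1 (Dual (multiplicative_character d0 dD)).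
  by rewrite /= ffunE.
have: translmx a = translmx 0.
  apply: (can_inj (mulKmx Pu)); rewrite Pd d1 mul1mx translmx0 mulmx1 //.
move/matrixP/(_ (enum_rank a) (enum_rank 0)); rewrite !mxE !enum_rankK !addr0.
by rewrite eqxx; case: eqP => // _ /eqP; rewrite oner_eq0.
Qed.

(** If x a is not 1, translating the summation variable by a multiplies the sum
    by x a, so the sum vanishes. *)
Lemma sum_character (x : dual C A) : \sum_a x a = #|A|%:R *+ (x == 0).
Proof.
have [->|x0] := eqVneq x 0.
  by rewrite (eq_bigr (fun=> 1)) ?sumr_const // => a _; rewrite ffunE.
have [a xa] : exists a, x a != 1.
  apply/existsP; apply: contraNT x0 => /existsPn xa1; apply/eqP/dual_eqP => a.
  by rewrite [RHS]ffunE; apply/eqP/negPn.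
apply: (mulfI (_ : 1 - x a != 0)); first by rewrite subr_eq0 eq_sym.
rewrite mulr0n mulr0 mulrBl mul1r mulr_sumr.
apply/eqP; rewrite subr_eq0; apply/eqP.
by rewrite (reindex_inj (addrI a)); apply: eq_bigr => b _; rewrite dualD.
Qed.

(** The dual argument: here the translation is by a character y with y a
    different from 1, which exists because characters separate points. *)
Lemma sum_dual (a : A) :
  \sum_(x : dual C A) x a = #|{: dual C A}|%:R *+ (a == 0).
Proof.
have [->|a0] := eqVneq a 0.
  by rewrite (eq_bigr (fun=> 1)) ?sumr_const // => x _; rewrite dual0.
have [y ya] : exists y : dual C A, y a != 1.
  apply/existsP; apply: contraNT a0 => /existsPn xa1.
  by apply/eqP/characters_separate => x; apply/eqP/negPn.
apply: (mulfI (_ : 1 - y a != 0)); first by rewrite subr_eq0 eq_sym.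
rewrite mulr0n mulr0 mulrBl mul1r mulr_sumr.
apply/eqP; rewrite subr_eq0; apply/eqP.
by rewrite (reindex_inj (addrI y)); apply: eq_bigr => b _; rewrite ffunE.
Qed.

End Characters.

(** * Weyl operators *)

Lemma sum_enum_rank (C : nmodType) (T : finType) (F : 'I_#|T| -> C) :
  \sum_k F k = \sum_(x : T) F (enum_rank x).
Proof. exact: reindex (onW_bij _ (@enum_rank_bij T)). Qed.

Section WeylMatrices.
Variables (C : numClosedFieldType) (A : finZmodType).
Notation V := (A * dual C A)%type.

Lemma beta_neq0 (v w : V) : beta v w != 0.
Proof. exact: dual_neq0. Qed.

Lemma weylmx0 : weylmx (0 : V) = 1%:M.
Proof.
apply/matrixP=> i j; rewrite !mxE /= ffunE add0r.
by rewrite (inj_eq enum_val_inj).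
Qed.

Lemma weylmxM (v w : V) : weylmx v *m weylmx w = beta v w *: weylmx (v + w).
Proof.
apply/matrixP=> i j; rewrite !mxE (bigD1 (enum_rank (w.1 + enum_val j))) //=.
rewrite !mxE enum_rankK eqxx mulr1n big1 ?addr0 => [|k].
  rewrite ffunE dualD addrA mulrnAl mulrnAr; congr (_ *+ _).
  by rewrite /beta mulrA.
rewrite !mxE; case: (enum_val k =P _) => [<-|_ _]; last by rewrite mulr0n mulr0.
by rewrite enum_valK eqxx.
Qed.

Lemma weylmx_trace (v : V) : \tr (weylmx v) = #|A|%:R *+ (v == 0).
Proof.
rewrite /mxtrace sum_enum_rank.
have -> : (v == 0) = (v.1 == 0) && (v.2 == 0) by case: v.
under eq_bigr => a _ do rewrite mxE enum_rankK -{2}[a]add0r (inj_eq (addIr a)).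
rewrite eq_sym; case: eqP => _; first by rewrite /= -sum_character.
by rewrite big1.
Qed.

Lemma weylmx_unit (v : V) : weylmx v \in unitmx.
Proof.
have : (beta v (- v))^-1 *: (weylmx v *m weylmx (- v)) = 1%:M.
  by rewrite weylmxM subrr weylmx0 scalerA mulVf ?beta_neq0 ?scale1r.
by rewrite scalemxAr => /mulmx1_unit[].
Qed.

Lemma invmx_weylmx (v : V) :
  invmx (weylmx v) = (beta v (- v))^-1 *: weylmx (- v).
Proof.
apply: (can_inj (mulKmx (weylmx_unit v))).
rewrite mulmxV ?weylmx_unit // -scalemxAr weylmxM subrr weylmx0 scalerA.
by rewrite mulVf ?beta_neq0 ?scale1r.
Qed.

Lemma weylmx_orthogonal (v w : V) :
  \tr (invmx (weylmx v) *m weylmx w) = #|A|%:R *+ (v == w).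
Proof.
have [<-|vw] := eqVneq v w; first by rewrite mulVmx ?weylmx_unit // mxtrace1.
rewrite invmx_weylmx -scalemxAl weylmxM !mxtraceZ weylmx_trace addrC.
by rewrite subr_eq0 eq_sym (negbTE vw) !mulr0n !mulr0.
Qed.

Fact weyl_op_is_linear : linear (@weyl_op C A).
Proof.
move=> c x y; rewrite /weyl_op scaler_sumr -big_split; apply: eq_bigr => v _.
by rewrite !ffunE scalerDl scalerA.
Qed.
HB.instance Definition _ := GRing.isLinear.Build C (weyl C A) _ _ (@weyl_op C A)
  weyl_op_is_linear.

Lemma weyl_opK : cancel (@weyl_op C A) (@op_weyl C A).
Proof.
move=> x; apply/ffunP=> v; rewrite ffunE /weyl_op mulmx_sumr raddf_sum /=.
rewrite (bigD1 v) //= -scalemxAr mxtraceZ weylmx_orthogonal eqxx.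
rewrite big1 ?addr0 ?mulfK ?cardA_neq0 // => w /negbTE wv.
by rewrite -scalemxAr mxtraceZ weylmx_orthogonal eq_sym wv mulr0n mulr0.
Qed.

(** The elementary matrix |a><b| is, up to a factor, the sum over all
    characters x of x (- b) W_(a - b, x): summing over x selects the column b,
    and translation by a - b then puts the entry in the row a. *)
Lemma delta_weyl_op (a b : A) : exists x : weyl C A,
  weyl_op x = delta_mx (enum_rank a) (enum_rank b).
Proof.
have D0 : #|{: dual C A}|%:R != 0 :> C.
  by rewrite pnatr_eq0 -lt0n; apply/card_gt0P; exists 0.
exists [ffun v : V => #|{: dual C A}|%:R^-1 * (v.2 (- b) *+ (v.1 == a - b))].
apply/matrixP=> i j; rewrite /weyl_op summxE.
under eq_bigr => v _ do rewrite ffunE !mxE.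
rewrite -(pair_bigA _ (fun c (x : dual C A) => #|{: dual C A}|%:R^-1 *
   (x (- b) *+ (c == a - b)) *
   (x (enum_val j) *+ (enum_val i == c + enum_val j)))).
rewrite /= (bigD1 (a - b)) //= [X in _ + X]big1 ?addr0; last first.
  move=> c /negbTE cab; rewrite big1 // => x _.
  by rewrite cab mulr0n mulr0 mul0r.
under eq_bigr => x _ do
  rewrite eqxx mulr1n -mulrA mulrnAr -dualD -addrA.
rewrite -mulr_sumr sumrMnl sum_dual mxE.
rewrite 2!mulrnAr mulVf // -mulrnA mulnb.
rewrite -!(can2_eq (@enum_valK A) (@enum_rankK A)) ![- b + _]addrC subr_eq0.
have [->|bj] := eqVneq; last by rewrite andbF.
by rewrite subrr addr0 eq_sym andbT.
Qed.

Lemma op_weylK : cancel (@op_weyl C A) (@weyl_op C A).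
Proof.
move=> M; suff [x <-] : exists x, weyl_op x = M by rewrite weyl_opK.
pose e a b := sval (cid (delta_weyl_op a b)).
exists (\sum_i \sum_j M i j *: e (enum_val i) (enum_val j)).
rewrite linear_sum /= [RHS]matrix_sum_delta; apply: eq_bigr => i _.
rewrite linear_sum /=; apply: eq_bigr => j _; rewrite linearZ /= /e.
by case: cid => x /= ->; rewrite !enum_valK.
Qed.

End WeylMatrices.

(** * Tensor products of operators *)

Lemma prod_natr_eq (R : comNzRingType) (I : finType) (T : eqType)
    (f g : {ffun I -> T}) :
  \prod_k (f k == g k)%:R = (f == g)%:R :> R.
Proof.
have [->|fg] := eqVneq f g; first by rewrite big1 // => k _; rewrite eqxx.
have [k fgk] : exists k, f k != g k.
  apply/existsP; apply: contraNT fg => /existsPn fg.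
  by apply/eqP/ffunP => k; apply/eqP/negPn.
by rewrite (bigD1 k) //= (negbTE fgk) mul0r.
Qed.

Section TensorOperators.
Variables (C : numClosedFieldType) (A : finZmodType) (s : nat).
Implicit Types M N : 'I_s -> 'M[C]_#|A|.

Lemma tensor_opM M N :
  tensor_op M *m tensor_op N = tensor_op (fun k => M k *m N k).
Proof.
apply/matrixP=> i j; rewrite !mxE sum_enum_rank.
under [RHS]eq_bigr => k _ do rewrite mxE sum_enum_rank.
rewrite bigA_distr_bigA; apply: eq_bigr => f _.
by rewrite !mxE enum_rankK -big_split.
Qed.

Lemma tensor_op1 : tensor_op (fun _ : 'I_s => 1%:M : 'M[C]_#|A|) = 1%:M.
Proof.
apply/matrixP=> i j; rewrite !mxE -(inj_eq enum_val_inj) -prod_natr_eq.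
by apply: eq_bigr => k _; rewrite mxE (inj_eq enum_rank_inj).
Qed.

Lemma tensor_op_trace M : \tr (tensor_op M) = \prod_k \tr (M k).
Proof.
rewrite /mxtrace sum_enum_rank.
under [RHS]eq_bigr => k _ do rewrite sum_enum_rank.
by rewrite bigA_distr_bigA; apply: eq_bigr => f _; rewrite mxE enum_rankK.
Qed.

Lemma tensor_opZ (c : 'I_s -> C) M :
  tensor_op (fun k => c k *: M k) = (\prod_k c k) *: tensor_op M.
Proof.
apply/matrixP=> i j; rewrite !mxE -big_split.
by apply: eq_bigr => k _; rewrite mxE.
Qed.

Lemma eq_tensor_op M N : M =1 N -> tensor_op M = tensor_op N.
Proof. by move=> /funext ->. Qed.

Lemma tensor_op_inv M : (forall k, M k \in unitmx) ->
  tensor_op M \in unitmx /\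
  invmx (tensor_op M) = tensor_op (fun k => invmx (M k)).
Proof.
move=> Mu; have MV : tensor_op M *m tensor_op (fun k => invmx (M k)) = 1%:M.
  rewrite tensor_opM -[RHS]tensor_op1.
  by apply: eq_tensor_op => k; rewrite mulmxV.
have [u _] := mulmx1_unit MV; split=> //.
by rewrite -[RHS](mulKmx u) MV mulmx1.
Qed.

Lemma delta_tensor_op (i j : 'I_#|{ffun 'I_s -> A}|) :
  delta_mx i j = tensor_op (fun k =>
    delta_mx (enum_rank ((enum_val i : {ffun 'I_s -> A}) k))
             (enum_rank ((enum_val j : {ffun 'I_s -> A}) k))) :> 'M[C]_#|_|.
Proof.
apply/matrixP=> i' j'; rewrite !mxE -2!(inj_eq enum_val_inj) -mulnb natrM.
rewrite -!prod_natr_eq -big_split; apply: eq_bigr => k _.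
by rewrite /= mxE !(inj_eq enum_rank_inj) -natrM mulnb.
Qed.

End TensorOperators.

(** * Tensor powers of the Weyl algebra *)

Section WeylTensor.
Variables (C : numClosedFieldType) (A : finZmodType).
Notation V := (A * dual C A)%type.

Section Power.
Variable s : nat.
Implicit Types (x y z : weylT C A s) (v w : {ffun 'I_s -> V}).

Lemma weylT_sum x : x = \sum_v x v *: uT v.
Proof.
apply/ffunP=> v; rewrite sum_ffunE (bigD1 v) //= !ffunE eqxx.
rewrite big1 ?addr0 ?[_ *: _]mulr1 // => w /negbTE wv.
by rewrite !ffunE eq_sym wv scaler0.
Qed.

Fact weyl_opT_is_linear : linear (@weyl_opT C A s).
Proof.
move=> c x y; rewrite /weyl_opT scaler_sumr -big_split; apply: eq_bigr => v _.
by rewrite !ffunE scalerDl scalerA.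
Qed.
HB.instance Definition _ := GRing.isLinear.Build C (weylT C A s) _ _
  (@weyl_opT C A s) weyl_opT_is_linear.

Lemma weyl_opT_uT v : weyl_opT (uT v) = tensor_op (fun k => weylmx (v k)).
Proof.
rewrite /weyl_opT (bigD1 v) //= ffunE eqxx scale1r big1 ?addr0 //.
by move=> w /negbTE wv; rewrite ffunE wv scale0r.
Qed.

(** This form of the product makes its linearity in y visible. *)
Lemma weyl_mul_sumr x y : weyl_mul x y =
  \sum_w y w *: \sum_v (x v * \prod_(i < s) beta (v i) (w i)) *: uT (v + w).
Proof.
rewrite /weyl_mul exchange_big; apply: eq_bigr => w _; rewrite scaler_sumr.
by apply: eq_bigr => v _; rewrite scalerA mulrCA mulrA.
Qed.

Fact weyl_mul_is_linear x : linear (weyl_mul x).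
Proof.
move=> c y z; rewrite !weyl_mul_sumr scaler_sumr -big_split.
by apply: eq_bigr => v _; rewrite !ffunE scalerDl scalerA.
Qed.
HB.instance Definition _ x := GRing.isLinear.Build C (weylT C A s)
  (weylT C A s) _ (weyl_mul x) (weyl_mul_is_linear x).

Fact weyl_tr_is_scalar : scalar (@weyl_tr C A s).
Proof. by move=> c x y; rewrite /weyl_tr linearP mxtraceD mxtraceZ. Qed.
HB.instance Definition _ := GRing.isLinear.Build C (weylT C A s) C _
  (@weyl_tr C A s) weyl_tr_is_scalar.

Lemma weyl_opTM x y : weyl_opT (weyl_mul x y) = weyl_opT x *m weyl_opT y.
Proof.
pose W v := tensor_op (fun k => weylmx (v k : V)).
have opE z : weyl_opT z = \sum_(v : {ffun 'I_s -> V}) z v *: W v by [].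
rewrite /weyl_mul linear_sum /= (opE x) mulmx_suml; apply: eq_bigr => v _.
rewrite linear_sum /= -scalemxAl (opE y) mulmx_sumr scaler_sumr.
apply: eq_bigr => w _.
rewrite linearZ /= weyl_opT_uT -scalemxAr scalerA tensor_opM.
rewrite (eq_tensor_op (fun k => weylmxM (v k) (w k))) tensor_opZ scalerA.
by congr (_ *: _); apply: eq_tensor_op => k; rewrite ffunE.
Qed.

Lemma weyl_tr_uT v : weyl_tr (uT v) = #|A|%:R ^+ s *+ (v == 0).
Proof.
rewrite /weyl_tr weyl_opT_uT tensor_op_trace.
rewrite -mulr_natr -prod_natr_eq -[s in _ ^+ s]card_ord -prodr_const -big_split.
by apply: eq_bigr => k _; rewrite /= weylmx_trace ffunE mulr_natr.
Qed.

Lemma weyl_mul_uT v w :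
  weyl_mul (uT v) (uT w) = (\prod_(i < s) beta (v i) (w i)) *: uT (v + w).
Proof.
rewrite weyl_mul_sumr (bigD1 w) //= ffunE eqxx scale1r.
rewrite [X in _ + X]big1 ?addr0; last first.
  by move=> w' /negbTE ww; rewrite ffunE ww scale0r.
rewrite (bigD1 v) //= ffunE eqxx mul1r [X in _ + X]big1 ?addr0 //.
by move=> v' /negbTE vv; rewrite ffunE vv mul0r scale0r.
Qed.

(** The basis dual to (uT v) under the trace pairing is
    (trace_norm v)^-1 *: uT (- v). *)
Definition trace_norm v : C := weyl_tr (weyl_mul (uT v) (uT (- v))).

Lemma trace_norm_neq0 v : trace_norm v != 0.
Proof.
rewrite /trace_norm weyl_mul_uT linearZ /= weyl_tr_uT subrr eqxx.
rewrite mulf_neq0 //; last by rewrite mulr1n expf_neq0 // cardA_neq0.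
by apply/prodf_neq0 => i _; apply: beta_neq0.
Qed.

Lemma weyl_trMuT x w : weyl_tr (weyl_mul x (uT (- w))) = x w * trace_norm w.
Proof.
rewrite weyl_mul_sumr (bigD1 (- w)) //= ffunE eqxx scale1r.
rewrite [X in _ + X]big1 ?addr0; last first.
  by move=> w' /negbTE ww; rewrite ffunE ww scale0r.
rewrite linear_sum /= (bigD1 w) //= [X in _ + X]big1 ?addr0; last first.
  by move=> v vw; rewrite linearZ /= weyl_tr_uT subr_eq0 (negbTE vw) mulr0.
by rewrite /trace_norm weyl_mul_uT !linearZ /= mulrA.
Qed.

(** By weyl_trMuT, the coordinates of x can be read off from traces of products
    of weyl_opT x with Weyl operators. *)
Lemma weyl_opT_inj : injective (@weyl_opT C A s).
Proof.
move=> x y xy; apply/ffunP=> v; apply: (mulIf (trace_norm_neq0 v)).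
by rewrite -!weyl_trMuT /weyl_tr !weyl_opTM xy.
Qed.

Lemma weyl_opT_tensor (x : 'I_s -> weyl C A) :
  weyl_opT (tensor x) = tensor_op (fun k => weyl_op (x k)).
Proof.
apply/matrixP=> i j; rewrite /weyl_opT summxE mxE.
under [RHS]eq_bigr => k _ do rewrite /weyl_op summxE.
rewrite bigA_distr_bigA; apply: eq_bigr => v _.
rewrite !mxE ffunE -big_split; apply: eq_bigr => k _.
by rewrite !mxE.
Qed.

(** Elementary matrices are tensor products of elementary matrices, each of
    which is in the image of weyl_op. *)
Lemma weyl_opT_surj (M : 'M[C]_#|{ffun 'I_s -> A}|) : exists x, weyl_opT x = M.
Proof.
exists (\sum_i \sum_j M i j *: tensor (fun k => op_weyl
   (delta_mx (enum_rank ((enum_val i : {ffun 'I_s -> A}) k))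
             (enum_rank ((enum_val j : {ffun 'I_s -> A}) k))))).
rewrite linear_sum /= [RHS]matrix_sum_delta; apply: eq_bigr => i _.
rewrite linear_sum /=; apply: eq_bigr => j _; rewrite linearZ /=.
rewrite weyl_opT_tensor delta_tensor_op; congr (_ *: _).
by apply: eq_tensor_op => k; rewrite op_weylK.
Qed.

Lemma weyl_opT1 : weyl_opT (uT (0 : {ffun 'I_s -> V})) = 1%:M.
Proof.
rewrite weyl_opT_uT -tensor_op1; apply: eq_tensor_op => k.
by rewrite ffunE weylmx0.
Qed.

End Power.
End WeylTensor.

(** * The action of the Clifford group *)

Section CliffordAction.
Variables (C : numClosedFieldType) (A : finZmodType).
Notation V := (A * dual C A)%type.
Implicit Types (g : clifford C A).

Definition clifford_op s g : 'M[C]_#|{ffun 'I_s -> A}| :=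
  tensor_op (fun=> clifford_rep g).

Lemma clifford_rep_unit g : clifford_rep g \in unitmx.
Proof.
rewrite /clifford_rep; case: (generic_quotient.repr g) => U /= /asboolP[Uu _].
exact: unitarymx_unit.
Qed.

Lemma clifford_op_unit s g : clifford_op s g \in unitmx.
Proof. by case: (@tensor_op_inv C A s _ (fun=> clifford_rep_unit g)). Qed.

Lemma weyl_op_u (v : V) : weyl_op (u_ v) = weylmx v.
Proof.
rewrite /weyl_op (bigD1 v) //= ffunE eqxx scale1r big1 ?addr0 //.
by move=> w /negbTE wv; rewrite ffunE wv scale0r.
Qed.

Fact alphaT_is_linear s g : linear (@alphaT C A s g).
Proof.
move=> c x y; rewrite /alphaT scaler_sumr -big_split; apply: eq_bigr => v _.
by rewrite !ffunE scalerDl scalerA.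
Qed.
HB.instance Definition _ s g := GRing.isLinear.Build C (weylT C A s)
  (weylT C A s) _ (@alphaT C A s g) (alphaT_is_linear g).

Lemma weyl_opT_alphaT s g (x : weylT C A s) : weyl_opT (alphaT g x) =
  clifford_op s g *m weyl_opT x *m invmx (clifford_op s g).
Proof.
rewrite {2}/weyl_opT mulmx_sumr mulmx_suml /alphaT linear_sum /=.
apply: eq_bigr => v _; rewrite linearZ /= -scalemxAr -scalemxAl; congr (_ *: _).
have [_ ->] := @tensor_op_inv C A s _ (fun=> clifford_rep_unit g).
rewrite !tensor_opM weyl_opT_tensor; apply: eq_tensor_op => k.
by rewrite /alpha op_weylK weyl_op_u.
Qed.

Lemma alphaT_surj s g (y : weylT C A s) : exists x, alphaT g x = y.
Proof.
have Uu := clifford_op_unit s g.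
have [x xE] :=
  weyl_opT_surj (invmx (clifford_op s g) *m weyl_opT y *m clifford_op s g).
exists x; apply: weyl_opT_inj; rewrite weyl_opT_alphaT xE.
by rewrite !mulmxA mulmxV // mul1mx mulmxK.
Qed.

Lemma alphaT_trace s g (x y : weylT C A s) :
  weyl_tr (weyl_mul (alphaT g x) (alphaT g y)) = weyl_tr (weyl_mul x y).
Proof.
have Uu := clifford_op_unit s g.
rewrite /weyl_tr !weyl_opTM !weyl_opT_alphaT !mulmxA mulmxKV // mxtrace_mulC.
by rewrite !mulmxA mulVmx // mul1mx.
Qed.

(** The invariants are the commutant of U_g^((x) s): conjugation by U_g^((x) s)
    fixes an operator exactly when the two commute. *)
Lemma clifford_invariantE s (x : weylT C A s) :
  clifford_invariants (weyl_opT x) <-> forall g, alphaT g x = x.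
Proof.
split=> [inv g|inv g]; have Uu := clifford_op_unit s g.
  apply: weyl_opT_inj; rewrite weyl_opT_alphaT.
  by rewrite -(inv g) mulmxK.
rewrite -{1}(inv g) weyl_opT_alphaT.
by rewrite mulmxKV.
Qed.

Lemma alphaT1 s g : alphaT g (uT 0) = uT (0 : {ffun 'I_s -> V}).
Proof.
apply: weyl_opT_inj; rewrite weyl_opT_alphaT weyl_opT1 mulmx1.
by rewrite mulmxV // clifford_op_unit.
Qed.

Section Split.
Variables s t : nat.
Implicit Types (x : weylT C A s) (y : weylT C A t).

Definition join_parts (v : {ffun 'I_s -> V}) (w : {ffun 'I_t -> V}) :
    {ffun 'I_(s + t) -> V} :=
  [ffun i => match fintype.split i with inl j => v j | inr j => w j end].

Lemma lpart_join v w : lpart (join_parts v w) = v.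
Proof. by apply/ffunP => i; rewrite !ffunE (unsplitK (inl _ i)). Qed.

Lemma rpart_join v w : rpart (join_parts v w) = w.
Proof. by apply/ffunP => i; rewrite !ffunE (unsplitK (inr _ i)). Qed.

Lemma join_lrpart p : join_parts (lpart p) (rpart p) = p.
Proof.
by apply/ffunP => i; rewrite ffunE; case: split_ordP => j ->; rewrite ffunE.
Qed.

Lemma sum_parts (M : nmodType) (F : {ffun 'I_(s + t) -> V} -> M) :
  \sum_p F p = \sum_v \sum_w F (join_parts v w).
Proof.
rewrite pair_bigA /=.
rewrite (reindex (fun vw : {ffun 'I_s -> V} * {ffun 'I_t -> V} =>
  join_parts vw.1 vw.2)) //.
exists (fun p => (lpart p, rpart p)) => [[v w]|p] _ /=.
  by rewrite lpart_join rpart_join.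
exact: join_lrpart.
Qed.

Lemma tensor2_uT p :
  tensor2 (uT (lpart p)) (uT (rpart p)) = uT p :> weylT C A (s + t).
Proof.
apply/ffunP=> q; rewrite !ffunE -natrM mulnb; congr (nat_of_bool _)%:R.
apply/idP/idP => [/andP[/eqP l /eqP r]|/eqP->]; last by rewrite !eqxx.
by rewrite -(join_lrpart q) l r join_lrpart.
Qed.

Lemma alphaT_tensor2 g x y :
  alphaT g (tensor2 x y) = tensor2 (alphaT g x) (alphaT g y).
Proof.
apply/ffunP=> p; rewrite ffunE !sum_ffunE sum_parts mulr_suml.
apply: eq_bigr => v _; rewrite mulr_sumr; apply: eq_bigr => w _.
rewrite !ffunE lpart_join rpart_join big_split_ord /= [LHS]mulrACA.
by congr (_ * _ * (_ * _)); apply: eq_bigr => i _;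
  rewrite !ffunE ?(unsplitK (inl _ i)) ?(unsplitK (inr _ i)).
Qed.

End Split.
End CliffordAction.

(** * Endomorphisms as tensors *)

Section Theta.
Variables (C : numClosedFieldType) (A : finZmodType) (t : nat).
Notation V := (A * dual C A)%type.
Implicit Types (f : 'End(weylT C A t)) (x y z : weylT C A t)
  (X Y : weylT C A (t + t)) (g : clifford C A).

Lemma trace_endoE x y z : trace_endo x y z = weyl_tr (weyl_mul y z) *: x.
Proof.
pose F z := weyl_tr (weyl_mul y z) *: x.
have lin : linear F by move=> c u v; rewrite /F !linearP scalerDl scalerA.
pose H := GRing.isLinear.Build C (weylT C A t) (weylT C A t) _ F lin.
pose F' : {linear weylT C A t -> weylT C A t} := HB.pack F H.
exact: (lfunE F').
Qed.

(** The sum over v of f (uT v) (x) (uT v)', with (uT v)' the trace-dual basis: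
    its p-coordinate only involves the v whose dual vector is proportional to
    uT (rpart p), namely v = - rpart p. *)
Definition theta f : weylT C A (t + t) :=
  [ffun p => (trace_norm (rpart p))^-1 * f (uT (- rpart p)) (lpart p)].

Fact theta_is_linear : linear theta.
Proof.
move=> c f f'; apply/ffunP=> p; rewrite !ffunE add_lfunE scale_lfunE !ffunE.
by rewrite mulrDr [_ *: (_ * _)]mulrCA.
Qed.
HB.instance Definition _ := GRing.isLinear.Build C 'End(weylT C A t)
  (weylT C A (t + t)) _ theta theta_is_linear.

Lemma theta_trace_endo x y : theta (trace_endo x y) = tensor2 x y.
Proof.
apply/ffunP=> p; rewrite !ffunE trace_endoE ffunE weyl_trMuT.
rewrite -[_ *: _]/(y (rpart p) * trace_norm (rpart p) * x (lpart p)).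
by rewrite -mulrA mulrCA mulKf ?trace_norm_neq0 // mulrC.
Qed.

Lemma theta_inj : injective theta.
Proof.
move=> f f' ff'; apply/lfunP=> z; rewrite [z]weylT_sum !linear_sum.
apply: eq_bigr => v _; rewrite !linearZ; congr (_ *: _); apply/ffunP=> w.
have /ffunP/(_ (join_parts w (- v))) := ff'.
rewrite !ffunE lpart_join rpart_join opprK.
by apply: mulfI; rewrite invr_eq0 trace_norm_neq0.
Qed.

Definition endo_of X : 'End(weylT C A t) :=
  \sum_p X p *: trace_endo (uT (lpart p)) (uT (rpart p)).

Lemma endo_ofK : cancel endo_of theta.
Proof.
move=> X; rewrite linear_sum [RHS]weylT_sum; apply: eq_bigr => p _.
by rewrite linearZ /= theta_trace_endo tensor2_uT.
Qed.

Lemma thetaK : cancel theta endo_of.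
Proof. by move=> f; apply: theta_inj; rewrite endo_ofK. Qed.

Fact endo_of_is_linear : linear endo_of.
Proof. by move=> c X Y; apply: theta_inj; rewrite linearP /= !endo_ofK. Qed.
HB.instance Definition _ := GRing.isLinear.Build C (weylT C A (t + t))
  'End(weylT C A t) _ endo_of endo_of_is_linear.

(** By linearity it is enough to take X = x (x) y, for which the claim reads
    Tr ((g y) (g z)) g x = g (Tr (y z) x), the invariance of the trace. *)
Lemma endo_of_alphaT g X z :
  endo_of (alphaT g X) (alphaT g z) = alphaT g (endo_of X z).
Proof.
rewrite [X]weylT_sum (linear_sum (alphaT g)) !(linear_sum endo_of) !sum_lfunE.
rewrite (linear_sum (alphaT g)); apply: eq_bigr => p _.
rewrite /= [alphaT g (X p *: _)]linearZ /= !linearZ /= !scale_lfunE.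
rewrite [RHS]linearZ /=; congr (_ *: _).
rewrite -tensor2_uT alphaT_tensor2 -!theta_trace_endo !thetaK !trace_endoE.
by rewrite alphaT_trace [RHS]linearZ.
Qed.

(** If f commutes with g then endo_of (g (theta f)) and f agree on the image of
    g, which is everything, so g (theta f) = theta f; the converse is
    equivariance of endo_of alone. *)
Lemma commutantE f : commutant f <-> forall g, alphaT g (theta f) = theta f.
Proof.
split=> [fC g|fC g z]; last first.
  by rewrite -{1}[f]thetaK -(fC g) endo_of_alphaT thetaK.
apply: (can_inj endo_ofK); rewrite thetaK; apply/lfunP=> y.
have [z <-] := alphaT_surj g y.
by rewrite endo_of_alphaT thetaK fC.
Qed.

Lemma trace_endo_comp x y x' y' : (trace_endo x y \o trace_endo x' y')%VF =
  weyl_tr (weyl_mul y x') *: trace_endo x y'.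
Proof.
apply/lfunP=> z; rewrite comp_lfunE scale_lfunE !trace_endoE !linearZ /=.
by rewrite scalerA mulrC.
Qed.

(** Both sides are bilinear in X and Y; on basis vectors the identity is
    trace_endo_comp. *)
Lemma theta_endo_of_comp X Y :
  theta (endo_of X \o endo_of Y)%VF = contraction X Y.
Proof.
have -> : (endo_of X \o endo_of Y)%VF = \sum_p \sum_q
    (X p * Y q * weyl_tr (weyl_mul (uT (rpart p)) (uT (lpart q)))) *:
    trace_endo (uT (lpart p)) (uT (rpart q)).
  apply/lfunP=> z; rewrite comp_lfunE !sum_lfunE.
  apply: eq_bigr => p _; rewrite sum_lfunE linear_sum.
  apply: eq_bigr => q _.
  rewrite !scale_lfunE linearZ /= scale_lfunE -comp_lfunE.
  by rewrite trace_endo_comp scale_lfunE !scalerA mulrCA mulrA.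
rewrite linear_sum /=; apply: eq_bigr => p _; rewrite linear_sum /=.
by apply: eq_bigr => q _; rewrite linearZ /= theta_trace_endo.
Qed.

Lemma theta_comp f f' : theta (f \o f')%VF = contraction (theta f) (theta f').
Proof. by rewrite -theta_endo_of_comp !thetaK. Qed.

Lemma theta_commutant_bij : set_bij (@commutant C A t)
  (@clifford_invariants C A (t + t)) (fun f => weyl_opT (theta f)).
Proof.
split=> [f fC|f f' _ _ ff'|M Minv].
- exact/clifford_invariantE/commutantE.
- exact/theta_inj/weyl_opT_inj.
have [X XM] := weyl_opT_surj M; exists (endo_of X); last by rewrite endo_ofK.
apply/commutantE => g; rewrite endo_ofK.
by apply: (clifford_invariantE X).1; rewrite XM.
Qed.

(** z |-> Tr (z) 1: invariant under the Clifford group because the trace and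
    the unit are. *)
Definition trace_unit : 'End(weylT C A t) := trace_endo (uT 0) (uT 0).

Lemma trace_unit_commutant : commutant trace_unit.
Proof.
by apply/commutantE => g; rewrite theta_trace_endo alphaT_tensor2 !alphaT1.
Qed.

Lemma theta_trace_unit : theta trace_unit = uT 0.
Proof.
have [l0 r0] : @lpart C A t t 0 = 0 /\ @rpart C A t t 0 = 0.
  by split; apply/ffunP => i; rewrite !ffunE.
by rewrite theta_trace_endo -{1}l0 -r0 tensor2_uT.
Qed.

(** The two sides are N^t (1 (x) 1) and 1 (x) 1. *)
Lemma theta_not_mul : (0 < t)%N -> (1 < #|A|)%N ->
  theta (trace_unit \o trace_unit)%VF <>
  weyl_mul (theta trace_unit) (theta trace_unit).
Proof.
move=> t0 A1; rewrite trace_endo_comp linearZ /= theta_trace_unit.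
rewrite !weyl_mul_uT addr0 big1 => [|i _]; last by rewrite /beta ffunE dual0.
rewrite scale1r addr0 weyl_tr_uT eqxx => /ffunP/(_ 0); rewrite !ffunE eqxx.
rewrite big1 => [|i _]; last by rewrite /beta ffunE dual0.
move/eqP; rewrite scale1r [_ *: _]mulr1 -natrX pnatr_eq1.
by rewrite gtn_eqF // -(exp1n t) ltn_exp2r.
Qed.

End Theta.

Theorem proposition5p9 (R : realType) (A : finZmodType) (t : nat) :
  exists Theta : {linear 'End(weylT R[i] A t) -> weylT R[i] A (t + t)},
    [/\ forall x y : weylT R[i] A t, Theta (trace_endo x y) = tensor2 x y,
        set_bij (@commutant R[i] A t) (@clifford_invariants R[i] A (t + t))
          (fun f => weyl_opT (Theta f)),
        forall f g : 'End(weylT R[i] A t),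
          commutant f -> commutant g ->
          Theta (f \o g)%VF = contraction (Theta f) (Theta g)
      & (0 < t)%N -> (1 < #|A|)%N ->
        exists f g : 'End(weylT R[i] A t),
          [/\ commutant f, commutant g &
              Theta (f \o g)%VF <> weyl_mul (Theta f) (Theta g)]].
Proof.
exists (@theta R[i] A t : {linear _ -> _}); split.
- exact: theta_trace_endo.
- exact: theta_commutant_bij.
- by move=> f g _ _; apply: theta_comp.
move=> t0 A1; exists (trace_unit _ _ t), (trace_unit _ _ t).
by split; [exact: trace_unit_commutant..|exact: theta_not_mul].
Qed.
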